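(* Let $F$ be a field, let $n\ge 1$, and let $A = Fe_1\oplus Fe_2\oplus\ldots\oplus Fe_n$ be the direct sum of $n$ copies of $F$. Let $\lambda\in F$ with $\lambda\neq 0$. Then the number of different Rota–Baxter operators on $A$ of weight $\lambda$ equals $2^n(n+1)^{n-1}$.
   Context: $A = Fe_1\oplus\ldots\oplus Fe_n$ is the $n$-dimensional $F$-algebra $F^n$ with componentwise multiplication, where $e_ie_j=\delta_{ij}e_i$. A Rota–Baxter operator of weight $\lambda\in F$ on an $F$-algebra $A$ is an $F$-linear map $R\colon A\to A$ satisfying $R(x)R(y) = R(R(x)y + xR(y) + \lambda xy)$ for all $x,y\in A$. *)

(* Defs.v *)
From HB Require Import structures.
From mathcomp Require Import all_boot all_algebra.

Set Implicit Arguments.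
Unset Strict Implicit.
Unset Printing Implicit Defensive.

Import GRing.Theory.
Local Open Scope ring_scope.

Definition rota_baxter (F : fieldType) (A : lalgType F) (lambda : F)
    (R : A -> A) : Prop :=
  linear R /\
  forall x y : A, R x * R y = R (R x * y + x * R y + lambda *: (x * y)).

(* The algebra F^n. A ring of finite functions satisfies 1 != 0 only on a
   nonempty domain, so the type carries the proof that n > 0. [F^o] is [F] seen
   as a left module over itself. *)
Definition direct_sum (F : fieldType) (n : nat) (n_gt0 : (0 < n)%N) : Type :=
  {ffun 'I_n -> F^o}.

Section DirectSum.
Variables (F : fieldType) (n : nat) (n_gt0 : (0 < n)%N).
Local Notation A := (direct_sum F n_gt0).

HB.instance Definition _ := GRing.PzRing.copy A {ffun 'I_n -> F^o}.
HB.instance Definition _ := Vector.copy A {ffun 'I_n -> F^o}.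

HB.instance Definition _ := GRing.PzSemiRing_isNonZero.Build A
  (@ffun1_nonzero 'I_n F^o (Ordinal n_gt0)).

Fact direct_sum_mulC : @commutative A A *%R.
Proof. by move=> x y; apply/ffunP => i; rewrite !ffunE mulrC. Qed.

HB.instance Definition _ :=
  GRing.PzRing_hasCommutativeMul.Build A direct_sum_mulC.

Fact direct_sum_scalerAl (a : F) (x y : A) : a *: (x * y) = a *: x * y.
Proof. by apply/ffunP => i; rewrite !ffunE scalerAl. Qed.

HB.instance Definition _ :=
  GRing.Lmodule_isLalgebra.Build F A direct_sum_scalerAl.
HB.instance Definition _ := GRing.Lalgebra_isComAlgebra.Build F A.

Lemma direct_sum_addE (x y : A) i : (x + y) i = x i + y i.
Proof. by rewrite ffunE. Qed.

Lemma direct_sum_scaleE (a : F) (x : A) i : (a *: x) i = a * x i.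
Proof. by rewrite ffunE. Qed.

Lemma direct_sum_mulE (x y : A) i : (x * y) i = x i * y i.
Proof. by rewrite ffunE. Qed.

End DirectSum.

(* Main.v *)
(* Let m i k be the e_k-coordinate of R(e_i). The Rota-Baxter identity on the
   basis says m_ik m_jk = m_ij m_jk + m_ji m_ik + lambda delta_ij m_ik. Taking
   i = j forces m_ii in {0, -lambda} and m_ik in {0, 2 m_ii + lambda}, so up to a
   sign depending only on i the off-diagonal part is lambda times a 0/1 matrix a;
   for i != j the identity says that a is a strict order in which the predecessors
   of each point form a chain, i.e. the ancestor order of a rooted forest. The
   diagonal is free, whence the factor 2^n.
   Rooted forests on v points together with a colouring of their trees by x
   colours number x(x + v)^(v - 1): removing the root set S leaves a forest on the
   other points whose trees are coloured by S (by the root they hang from), so by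
   induction the count is the sum over k of C(v, k) x^k k v^(v - k - 1), which the
   binomial theorem evaluates. Take x = 1. *)
Require Import Defs.
From mathcomp Require Import all_boot all_algebra.
From HB Require Import structures.
From mathcomp Require Import ring zify.

Set Implicit Arguments.
Unset Strict Implicit.
Unset Printing Implicit Defensive.

Import GRing.Theory.

(** * Ancestor orders of rooted forests and their colourings *)

Section ForestOrders.
Variables (T : finType) (t0 : T).
Implicit Types (a : {set T * T}) (f g : {ffun T -> T}) (S V X : {set T}).

(** [(i, j) \in a] reads: [i] is a proper ancestor of [j]. *)
Definition forest_order V a :=
  [&& a \subset setX V V,
      [forall i, (i, i) \notin a],
      [forall i, forall j, forall k,
        ((i, j) \in a) ==> ((j, k) \in a) ==> ((i, k) \in a)]
    & [forall i, forall j, forall k,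
        ((i, k) \in a) ==> ((j, k) \in a) ==>
          [|| i == j, (i, j) \in a | (j, i) \in a]]].

Lemma forest_orderP V a :
  reflect [/\ forall i j, (i, j) \in a -> (i \in V) /\ (j \in V),
              forall i, (i, i) \notin a,
              forall i j k, (i, j) \in a -> (j, k) \in a -> (i, k) \in a
            & forall i j k, (i, k) \in a -> (j, k) \in a ->
                [\/ i = j, (i, j) \in a | (j, i) \in a]]
          (forest_order V a).
Proof.
apply: (iffP and4P) => [[sub irr tr ch]|[sub irr tr ch]]; split.
- by move=> i j /(subsetP sub); rewrite in_setX => /andP.
- exact/forallP.
- by move=> i j k aij ajk; move/forallP/(_ i)/forallP/(_ j)/forallP/(_ k): tr;
    rewrite aij ajk.
- move=> i j k aij ajk; move/forallP/(_ i)/forallP/(_ j)/forallP/(_ k): ch.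
  rewrite aij ajk /= => /or3P[/eqP|?|?];
    by [constructor 1 | constructor 2 | constructor 3].
- by apply/subsetP => -[i j] /sub[? ?]; rewrite in_setX; apply/andP.
- exact/forallP.
- by do 3![apply/forallP => ?]; apply/implyP => aij; apply/implyP; apply: tr.
- do 3![apply/forallP => ?]; apply/implyP => aij; apply/implyP => ajk.
  by case: (ch _ _ _ aij ajk) => [->|->|->]; rewrite ?eqxx ?orbT.
Qed.

(* A colouring is constant along the order, i.e. on each tree, and takes the junk
   value t0 outside V. *)
Definition colored_forests V X :=
  [set p : {set T * T} * {ffun T -> T} |
    [&& forest_order V p.1, p.2 \in pffun_on t0 (mem V) (mem X)
      & [forall i, forall j, ((i, j) \in p.1) ==> (p.2 i == p.2 j)]]].

Lemma pffun_on_ifP V X f :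
  reflect (forall v, if v \in V then (f v \in X : Prop) else f v = t0)
          (f \in pffun_on t0 (mem V) (mem X)).
Proof.
apply: (iffP pfamilyP) => [[/supportP sup im] v|fP].
  by case: ifPn => [/im|/sup].
split; last by move=> v vV; have := fP v; rewrite vV.
by apply/supportP => v /negPf vV; have := fP v; rewrite vV.
Qed.

Lemma colored_forestsP V X a f :
  reflect [/\ forest_order V a,
              forall v, if v \in V then (f v \in X : Prop) else f v = t0
            & forall i j, (i, j) \in a -> f i = f j]
          ((a, f) \in colored_forests V X).
Proof.
rewrite inE /=; apply: (iffP and3P) => [[aP /pffun_on_ifP fP cP]|[aP fP cP]].
  split=> // i j aij; move/forallP/(_ i)/forallP/(_ j): cP.
  by rewrite aij => /eqP.
split=> //; first exact/pffun_on_ifP.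
by do 2![apply/forallP => ?]; apply/implyP => /cP ->.
Qed.

(** * Decomposition of a coloured forest along its root set *)

Definition roots V a := [set v in V | [forall u, (u, v) \notin a]].

Lemma rootsP V a v :
  reflect (v \in V /\ forall u, (u, v) \notin a) (v \in roots V a).
Proof. by rewrite inE; apply: (iffP andP) => -[? /forallP]. Qed.

(** An ancestor of [v] with fewest predecessors has none: by transitivity and irreflexivity, any
    predecessor of it would be an ancestor of [v] with strictly fewer. *)
Lemma exists_root V a v : forest_order V a -> v \in V -> v \notin roots V a ->
  exists2 r, r \in roots V a & (r, v) \in a.
Proof.
case/forest_orderP => sub irr tr _ vV vnR.
have [u0 au0]: exists u, (u, v) \in a.
  move: vnR; rewrite inE vV negb_forall /= => /existsP[u].
  by rewrite negbK; exists u.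
case: (@arg_minnP _ u0 (fun u => (u, v) \in a)
        (fun u => #|[set w | (w, u) \in a]|) au0) => r arv rmin.
exists r => //; apply/rootsP; split=> [|w]; first by have [] := sub _ _ arv.
apply/negP => awr; have := rmin w (tr _ _ _ awr arv).
rewrite leqNgt => /negP; apply; apply/proper_card/properP.
split; first by apply/subsetP => z; rewrite !inE => /tr; apply.
by exists w; rewrite !inE // (negPf (irr _)).
Qed.

(* q = (colours of the roots S, (forest on V \ S, its colouring by S)). *)
Definition graft V S (q : {ffun T -> T} * ({set T * T} * {ffun T -> T})) :
    {set T * T} * {ffun T -> T} :=
  (q.2.1 :|: [set e | [&& e.1 \in S, e.2 \in V :\: S & q.2.2 e.2 == e.1]],
   [ffun v => if v \in S then q.1 v
              else if v \in V then q.1 (q.2.2 v) else t0]).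

(** The domain on which [graft V S] is a bijection onto the coloured forests with root set [S]. *)
Definition graft_data V S X :=
  setX [set f | f \in pffun_on t0 (mem S) (mem X)] (colored_forests (V :\: S) S).

Lemma graft_dataP V S X f a g :
  reflect ((forall v, if v \in S then (f v \in X : Prop) else f v = t0) /\
           (a, g) \in colored_forests (V :\: S) S)
          ((f, (a, g)) \in graft_data V S X).
Proof.
rewrite in_setX in_set.
by apply: (iffP andP) => -[fP ?]; split => //; apply/pffun_on_ifP.
Qed.

(** The colour [g v] names the root placed above [v]. As [g] is constant on trees, a whole tree goes
    under one root, which gives transitivity and the chain condition. *)
Lemma graft_forest V S X q : S \subset V -> q \in graft_data V S X ->
  (graft V S q \in colored_forests V X) && (roots V (graft V S q).1 == S).
Proof.
move=> /subsetP sSV; case: q => f0 [a g] /graft_dataP[f0P].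
case/colored_forestsP => /forest_orderP[sub irr tr ch] gP cg.
have gS v : v \in V -> v \notin S -> g v \in S.
  by move=> vV vS; have := gP v; rewrite in_setD vV vS.
have subV i j : (i, j) \in a -> [/\ i \in V, i \notin S, j \in V & j \notin S].
  by move=> /sub[]; rewrite !in_setD => /andP[-> ->] /andP[-> ->].
apply/andP; split; last first.
  apply/eqP/setP => v; apply/rootsP/idP => [[vV noP]|vS].
    apply/negPn/negP => vS; have /negP := noP (g v); apply.
    by rewrite !inE /= vV vS eqxx gS // orbT.
  split=> [|u]; first exact: sSV.
  rewrite !inE /= vS /= andbF orbF; apply/negP => /subV[_ _ _].
  by rewrite vS.
apply/colored_forestsP; split=> [|v|i j].
- apply/forest_orderP; split=> [i j|i|i j k|i j k]; rewrite !inE /=.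
  + by case/orP => [/subV[]|/and3P[/sSV -> /andP[_ ->]]].
  + by rewrite negb_or irr; case: (i \in S).
  + move=> /orP[aij|/and3P[iS /andP[jS jV] /eqP gj]].
      have [iV iS jV jS] := subV _ _ aij.
      by rewrite (negPf jS) orbF /= => /(tr _ _ _ aij) ->.
    rewrite (negPf jS) /= orbF => ajk; have [_ _ -> ->] := subV _ _ ajk.
    by rewrite iS -(cg _ _ ajk) gj eqxx orbT.
  + move=> /orP[aik|/and3P[iS /andP[kS kV] /eqP gk]].
      move=> /orP[ajk|/and3P[jS /andP[kS kV] /eqP gk]].
        by case: (ch _ _ _ aik ajk) => [->|aij|aji];
          [constructor 1 | constructor 2; rewrite aij
          | constructor 3; rewrite aji].
      constructor 3; have [-> -> _ _] := subV _ _ aik.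
      by rewrite jS (cg _ _ aik) gk eqxx orbT.
    move=> /orP[ajk|/and3P[jS _ /eqP <-]]; last by constructor 1.
    constructor 2; have [-> -> _ _] := subV _ _ ajk.
    by rewrite iS (cg _ _ ajk) gk eqxx orbT.
- rewrite ffunE /=; have := f0P v.
  case: (boolP (v \in S)) => [vS|vS _]; first by rewrite sSV.
  by case: (boolP (v \in V)) => // vV; have := f0P (g v); rewrite gS.
- rewrite !inE /= !ffunE => /orP[aij|/and3P[iS /andP[jS jV] /eqP gj]].
    have [iV iS jV jS] := subV _ _ aij.
    by rewrite (negPf iS) (negPf jS) iV jV (cg _ _ aij).
  by rewrite iS (negPf jS) jV gj.
Qed.

(** Pairs starting outside [S] recover [a], pairs starting in [S] recover [g], and the colours on
    [S] recover [f]; elsewhere both functions are [t0]. *)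
Lemma graft_inj V S X : {in graft_data V S X &, injective (graft V S)}.
Proof.
move=> [f [a g]] [f' [a' g']] /graft_dataP[fP].
case/colored_forestsP => /forest_orderP[sub _ _ _] gP _.
case/graft_dataP => f'P.
case/colored_forestsP => /forest_orderP[sub' _ _ _] g'P _.
rewrite /graft /= => -[/setP Ea /ffunP Ef].
have nS (b : {set T * T}) : (forall i j, (i, j) \in b -> i \in V :\: S /\ j \in V :\: S) ->
    forall i j, i \in S -> (i, j) \in b = false.
  by move=> subb i j iS; apply/negP => /subb[]; rewrite inE iS.
have -> : f = f'.
  apply/ffunP => v; have := Ef v; rewrite !ffunE.
  by have := fP v; have := f'P v; case: ifP => // _ -> ->.
have -> : a = a'.
  apply/setP => -[i j]; have := Ea (i, j); rewrite !inE /=.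
  case: (boolP (i \in S)) => iS; last by rewrite !orbF.
  by rewrite (nS a) ?(nS a').
suff -> : g = g' by [].
apply/ffunP => v; have := Ea (g v, v); have := gP v; have := g'P v.
case: ifPn => [vVS g'S gS|_ -> -> //].
rewrite in_setU [in RHS]in_setU (nS a) // (nS a') // !inE /= gS eqxx.
by move: vVS; rewrite inE => -> /esym/eqP.
Qed.

Lemma graft_surj V S X p : p \in colored_forests V X -> roots V p.1 = S ->
  exists2 q, q \in graft_data V S X & p = graft V S q.
Proof.
case: p => a f /colored_forestsP[aP fP cf] /= RS.
have [sub irr tr ch] := forest_orderP _ _ aP.
have SP v : v \in S -> v \in V /\ forall u, (u, v) \notin a.
  by rewrite -RS => /rootsP.
have exr v : v \in V :\: S -> exists r, (r \in S) && ((r, v) \in a).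
  rewrite inE -RS => /andP[vS vV]; have [r ? ?] := exists_root aP vV vS.
  by exists r; apply/andP.
(* [rt v] is the root above [v]; by [exr] the default [t0] is never reached on [V :\: S]. *)
pose rt v := odflt t0 [pick r | (r \in S) && ((r, v) \in a)].
have rtP v : v \in V :\: S -> rt v \in S /\ (rt v, v) \in a.
  move=> /exr[r rP]; rewrite /rt; case: pickP => [? /andP[]//|/(_ r)].
  by rewrite rP.
(* Two distinct roots above [v] would be comparable, but a root has no predecessor. *)
have rtU v r : r \in S -> (r, v) \in a -> r = rt v.
  move=> rS arv; have vVS : v \in V :\: S.
    rewrite inE (sub _ _ arv).2 andbT; apply/negP => /SP[_ /(_ r)].
    by rewrite arv.
  have [gS ag] := rtP _ vVS; case: (ch _ _ _ arv ag) => // H.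
    by have [_ /(_ r)] := SP _ gS; rewrite H.
  by have [_ /(_ (rt v))] := SP _ rS; rewrite H.
exists ([ffun v => if v \in S then f v else t0],
  ([set e in a | e.1 \notin S], [ffun v => if v \in V :\: S then rt v else t0])).
  apply/graft_dataP; split=> [v|].
    rewrite ffunE; case: (boolP (v \in S)) => // vS.
    by have := fP v; rewrite (SP _ vS).1.
  apply/colored_forestsP; split=> [|v|i j].
  - apply/forest_orderP; split=> [i j|i|i j k|i j k]; rewrite !inE /=.
    + move=> /andP[aij ->]; have [-> ->] := sub _ _ aij; rewrite !andbT.
      by split=> //; apply/negP => /SP[_ /(_ i)]; rewrite aij.
    + by rewrite (negPf (irr i)).
    + by move=> /andP[aij ->] /andP[ajk _]; rewrite (tr _ _ _ aij ajk).
    + move=> /andP[aik iS] /andP[ajk jS].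
      case: (ch _ _ _ aik ajk) => [->|aij|aji]; first by constructor 1.
        by constructor 2; rewrite aij.
      by constructor 3; rewrite aji.
  - by rewrite ffunE; case: (boolP (v \in V :\: S)) => // /rtP[].
  - rewrite inE /= => /andP[aij iS]; rewrite !ffunE !inE iS.
    have [-> jV] := sub _ _ aij; rewrite jV.
    have jS : j \notin S by apply/negP => /SP[_ /(_ i)]; rewrite aij.
    have iVS : i \in V :\: S by rewrite inE iS (sub _ _ aij).1.
    rewrite jS /=; have [rS ar] := rtP _ iVS.
    exact: rtU rS (tr _ _ _ ar aij).
rewrite /graft /=; congr pair.
  apply/setP => -[i j]; rewrite !inE /= !ffunE !inE.
  case: (boolP (i \in S)) => iS; last by rewrite andbT orbF.
  rewrite andbF /=; apply/idP/andP => [aij|[jVS]].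
    have [_ jV] := sub _ _ aij.
    have jS : j \notin S by apply/negP => /SP[_ /(_ i)]; rewrite aij.
    by rewrite jS jV /= -(rtU _ _ iS aij).
  by rewrite jVS => /eqP <-; apply: (rtP _ _).2; rewrite inE.
apply/ffunP => v; rewrite !ffunE; case: (boolP (v \in S)) => // vS.
case: (boolP (v \in V)) => vV; last by have := fP v; rewrite (negPf vV).
have vVS : v \in V :\: S by rewrite inE vS.
by rewrite vVS; have [-> /cf] := rtP _ vVS.
Qed.

(** * Counting coloured forests *)

Lemma card_colored_forests_rec V X :
  #|colored_forests V X| =
  \sum_(S : {set T} | S \subset V) #|X| ^ #|S| * #|colored_forests (V :\: S) S|.
Proof.
rewrite -sum1_card.
rewrite (partition_big (fun p => roots V p.1) (fun S : {set T} => S \subset V)) /=;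
  last by move=> p _; apply/subsetP => v /rootsP[].
apply: eq_bigr => S sSV; rewrite sum1dep_card.
transitivity #|[set graft V S q | q in graft_data V S X]|.
  apply: eq_card => p; rewrite [LHS]inE.
  apply/andP/imsetP => [[pP /eqP]|[q qP ->]]; first exact: graft_surj.
  exact/andP/graft_forest.
rewrite (card_in_imset (@graft_inj V S X)) cardsX; congr (_ * _).
by rewrite cardsE card_pffun_on.
Qed.

Lemma sum_subsets V (F : nat -> nat) :
  \sum_(S : {set T} | S \subset V) F #|S| =
  \sum_(k < #|V|.+1) 'C(#|V|, k) * F k.
Proof.
rewrite (partition_big (fun S => inord #|S| : 'I_#|V|.+1) xpredT) //=.
apply: eq_bigr => k _; rewrite -cards_draws -sum_nat_const.
apply: eq_big => [S|S /andP[sSV /eqP <-]].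
  rewrite inE; case: (boolP (S \subset V)) => //= sSV.
  by rewrite -val_eqE /= inordK // ltnS subset_leq_card.
by rewrite inordK // ltnS subset_leq_card.
Qed.

Lemma colored_forests_set0 X : #|colored_forests set0 X| = 1.
Proof.
rewrite -(cards1 (set0 : {set T * T}, [ffun _ : T => t0])).
apply: eq_card => -[a f]; rewrite [RHS]in_set1.
apply/colored_forestsP/eqP => [[/forest_orderP[sub _ _ _] fP _]|[-> ->]].
  congr pair; last by apply/ffunP => v; have := fP v; rewrite inE ffunE.
  by apply/setP => -[i j]; rewrite inE; apply/negP => /sub[]; rewrite inE.
split=> [|v|i j]; rewrite ?inE ?ffunE //.
by apply/forest_orderP; split=> [i j|i|i j k|i j k]; rewrite inE.
Qed.

(** Makes the term [S = set0] of the recursion vanish when [V] is nonempty. *)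
Lemma colored_forests_nocolor V : 0 < #|V| -> #|colored_forests V set0| = 0.
Proof.
rewrite card_gt0 => /set0Pn[v vV]; apply/eqP; rewrite cards_eq0 -subset0.
apply/subsetP => -[a f] /colored_forestsP[_ /(_ v)].
by rewrite vV inE.
Qed.

Lemma card_colored_forests V X :
  #|colored_forests V X| =
  if #|V| is m.+1 then #|X| * (#|X| + m.+1) ^ m else 1.
Proof.
have [n] := ubnP #|V|; elim: n => // n IHn in V X *; rewrite ltnS => leVn.
case cV: #|V| => [|m].
  by move/eqP: cV; rewrite cards_eq0 => /eqP ->; apply: colored_forests_set0.
rewrite card_colored_forests_rec.
(* [G k] is the inductive count on [V :\: S] coloured by [S], for [#|S| = k]; the default 1 is the
   case [S = V]. *)
pose G k := if m.+1 - k is j.+1 then k * (k + j.+1) ^ j else 1.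
transitivity (\sum_(S : {set T} | S \subset V) #|X| ^ #|S| * G #|S|).
  apply: eq_bigr => S sSV; congr (_ * _).
  have [->|S0] := eqVneq S set0.
    by rewrite setD0 colored_forests_nocolor ?cV // cards0.
  have cS : 0 < #|S| by rewrite card_gt0.
  have cD : #|V :\: S| = m.+1 - #|S| by rewrite cardsD (setIidPr sSV) cV.
  by rewrite IHn cD //; move: leVn; rewrite cV; lia.
(* As [G 0 = 0], only [k = i.+1] remains, to be matched termwise with the binomial expansion of
   [(m.+1 + #|X|) ^ m]. *)
rewrite (sum_subsets V (fun k => #|X| ^ k * G k)) cV big_ord_recl {1}/G /=.
rewrite !mul0n !muln0 add0n addnC expnDn big_distrr /=.
apply: eq_bigr => -[i] /=; rewrite ltnS => leim _.
rewrite /bump /= add1n /G subSS.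
case dm: (m - i) => [|j].
  have -> : i = m by lia.
  by rewrite !binn expnS; lia.
have -> : i.+1 + j.+1 = m.+1 by lia.
(* Absorption, [m.+1 * 'C(m, i) = i.+1 * 'C(m.+1, i.+1)], trades the factor [k] of [G k] for the
   missing power of [m.+1]. *)
have := mul_bin_diag m.+1 i; rewrite /= !expnS => E.
transitivity ((i.+1 * 'C(m.+1, i.+1)) *
  (#|X| * #|X| ^ i * m.+1 ^ j)); first by ring.
by rewrite -E; ring.
Qed.

(** With a single colour the colouring is forced. *)
Lemma card_forest_orders m : #|T| = m.+1 ->
  #|[set a | forest_order [set: T] a]| = #|T|.+1 ^ m.
Proof.
move=> cT; have := card_colored_forests [set: T] [set t0].
rewrite cardsT cT cards1 mul1n add1n => <-.
rewrite -[LHS]muln1 -(cards1 [ffun _ : T => t0]) -cardsX; apply: eq_card.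
move=> [a f]; rewrite in_setX inE /=.
apply/andP/colored_forestsP => [[aP]|[aP fP _]].
  by rewrite inE => /eqP ->; split=> // [v|i j _]; rewrite !ffunE ?inE.
split=> //; rewrite inE; apply/eqP/ffunP => v.
by have := fP v; rewrite !inE ffunE => /eqP.
Qed.

End ForestOrders.

(** * Solving the Rota-Baxter equations on matrix entries *)

Section Coefficients.
Local Open Scope ring_scope.
Variables (F : fieldType) (T : finType) (lambda : F).
Implicit Types (m : T -> T -> F) (D : {set T}) (a : {set T * T}).

Definition rb_coefficients m := forall i j k,
  m i k * m j k = m i j * m j k + m j i * m i k + lambda * (i == j)%:R * m i k.

(** [D] collects the [i] with diagonal entry [- lambda]. The nonzero off-diagonal value
    [2 m_ii + lambda] is then [- lambda] on [D] and [lambda] off it. *)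
Definition forest_coef D a i k : F :=
  if i == k then if i \in D then - lambda else 0
  else if (i, k) \in a then if i \in D then - lambda else lambda
  else 0.

Lemma forest_order_rb_coefficients D a :
  forest_order [set: T] a -> rb_coefficients (forest_coef D a).
Proof.
case/forest_orderP => _ irr tr ch i j k.
have anti u v : (u, v) \in a -> (v, u) \in a = false.
  by move=> uv; apply/negP => /(tr _ _ _ uv); apply/negP/irr.
rewrite /forest_coef; have [->{i}|ij] := eqVneq i j.
  have [->|jk] := eqVneq j k; first by rewrite ?eqxx /=; case: ifP => _; ring.
  by rewrite ?eqxx /=; case: ifP => _; case: ifP => _; ring.
rewrite !mulr0 mul0r addr0.
have [<-{k}|ik] := eqVneq i k.
  rewrite [j == i]eq_sym (negPf ij).
  case: (boolP ((i, j) \in a)) => [/anti ->|_]; ring.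
have [<-{k ik}|jk] := eqVneq j k.
  case: (boolP ((i, j) \in a)) => [/anti ->|_]; ring.
(* For distinct [i], [j], [k]: if both precede [k], comparability leaves exactly one term on the
   right; otherwise transitivity kills both. *)
case: (boolP ((i, k) \in a)) => aik; case: (boolP ((j, k) \in a)) => ajk.
- have [/eqP|aij|aji] := ch _ _ _ aik ajk; first by rewrite (negPf ij).
    by rewrite aij (anti _ _ aij); ring.
  by rewrite aji (anti _ _ aji); ring.
- case: (boolP ((j, i) \in a)) => [aji|_]; last by ring.
  by rewrite (tr _ _ _ aji aik) in ajk.
- case: (boolP ((i, j) \in a)) => [aij|_]; last by ring.
  by rewrite (tr _ _ _ aij ajk) in aik.
- by ring.
Qed.

Hypothesis lambda_neq0 : lambda != 0.

Lemma forest_coef_neq0 D a i k :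
  (forest_coef D a i k != 0) = (if i == k then i \in D else (i, k) \in a).
Proof.
rewrite /forest_coef.
by do ![case: ifP => _]; rewrite ?oppr_eq0 ?lambda_neq0 ?eqxx.
Qed.

(** The support determines [D] on the diagonal and [a] off it, even when [lambda = - lambda]. *)
Lemma forest_coef_inj D a D' a' :
  forest_order [set: T] a -> forest_order [set: T] a' ->
  forest_coef D a =2 forest_coef D' a' -> D = D' /\ a = a'.
Proof.
case/forest_orderP => _ irr _ _ /forest_orderP[_ irr' _ _] E.
have {}E i k : (if i == k then i \in D else (i, k) \in a) =
               (if i == k then i \in D' else (i, k) \in a').
  by rewrite -!forest_coef_neq0 E.
split; first by apply/setP => i; have := E i i; rewrite eqxx.
apply/setP => -[i k]; have := E i k; case: eqP => // -> _.
by rewrite (negPf (irr k)) (negPf (irr' k)).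
Qed.

Lemma rb_coefficients_forest m : rb_coefficients m ->
  exists D a, forest_order [set: T] a /\ m =2 forest_coef D a.
Proof.
move=> H.
have diag i : (m i i == 0) || (m i i == - lambda).
  have := H i i i; rewrite eqxx /= => E; rewrite -[_ == - _]subr_eq0 -mulf_eq0.
  apply/eqP; transitivity (m i i * m i i + m i i * m i i
    + lambda * 1%:R * m i i - m i i * m i i); first by ring.
  by rewrite -E subrr.
have line i k : (m i k == 0) || (m i k == m i i + m i i + lambda).
  have := H i i k; rewrite eqxx /= => E; rewrite -[X in _ || X]subr_eq0 -mulf_eq0.
  apply/eqP; transitivity (m i k * m i k - (m i i * m i k + m i i * m i k
    + lambda * 1%:R * m i k)); first by ring.
  by rewrite -E subrr.
(* At [k = i] the identity reduces to [m i j * m j i = 0]. *)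
have anti i j : i != j -> m i j != 0 -> m j i = 0.
  move=> ij mij; have := H i j i; rewrite (negPf ij) mulr0 mul0r addr0.
  rewrite mulrC => E; apply/eqP; rewrite -(mulrI_eq0 _ (mulfI mij)).
  by apply/eqP/(addIr (m j i * m i i)); rewrite -E add0r.
have offdiag i j k : i != j -> m i k * m j k = m i j * m j k + m j i * m i k.
  by move=> ij; rewrite H (negPf ij) mulr0 mul0r addr0.
exists [set i | m i i != 0], [set e | (e.1 != e.2) && (m e.1 e.2 != 0)].
split=> [|i k]; last first.
  rewrite /forest_coef !inE /=; have [<-|ik] := eqVneq i k.
    by have := diag i; case: eqP => [->|_ /eqP].
  have := line i k; case: eqP => //= _ /eqP ->.
  by have := diag i; case: eqP => [-> _|_ /= /eqP ->]; ring.
apply/forest_orderP; split=> [i j|i|i j k|i j k]; rewrite !inE ?eqxx //=.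
  move=> /andP[ij mij] /andP[jk mjk].
  have ik : i != k.
    by apply: contraNneq mjk => <-; rewrite (anti _ _ ij mij).
  (* Since [m j i = 0], the identity becomes [m i k * m j k = m i j * m j k], whose right side is
     nonzero. *)
  rewrite ik; have := offdiag i j k ij; rewrite (anti _ _ ij mij) mul0r addr0.
  move=> E; apply: contraNneq (mulf_neq0 mij mjk) => ik0.
  by rewrite -E ik0 mul0r.
move=> /andP[ik mik] /andP[jk mjk].
have [|ij] /= := eqVneq i j; first by constructor 1.
have [mij|mij] := eqVneq (m i j) 0; last by constructor 2.
have [mji|mji] := eqVneq (m j i) 0; last by constructor 3.
have := mulf_neq0 mik mjk.
by rewrite (offdiag _ _ _ ij) mij mji !mul0r addr0 eqxx.
Qed.

End Coefficients.

(** * Passing between operators and their matrices *)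

Section Operators.
Local Open Scope ring_scope.
Variables (F : fieldType) (n : nat) (n_gt0 : (0 < n)%N).
Local Notation A := (direct_sum F n_gt0).

Definition basis_vector (i : 'I_n) : A := [ffun k => (k == i)%:R].

Lemma direct_sum_sumE (I : Type) (r : seq I) (f : I -> A) k :
  (\sum_(i <- r) f i) k = \sum_(i <- r) (f i k : F).
Proof.
by apply: (big_morph (fun x : A => x k : F)) => [x y|];
  [apply: direct_sum_addE | rewrite ffunE].
Qed.

Lemma sum_basis_vector (x : A) : x = \sum_i (x i : F) *: basis_vector i.
Proof.
apply/ffunP => k; rewrite direct_sum_sumE (bigD1 k) //= big1 => [|i ik].
  by rewrite direct_sum_scaleE ffunE eqxx mulr1 addr0.
by rewrite direct_sum_scaleE ffunE eq_sym (negPf ik) mulr0.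
Qed.

Definition coefficients (R : 'End(A)) (i k : 'I_n) : F := R (basis_vector i) k.

Lemma coefficientsE (R : 'End(A)) (x : A) k :
  R x k = \sum_i (x i : F) * coefficients R i k.
Proof.
rewrite {1}(sum_basis_vector x) linear_sum direct_sum_sumE.
by apply: eq_bigr => i _; rewrite linearZ direct_sum_scaleE.
Qed.

Lemma coefficients_inj (R R' : 'End(A)) :
  coefficients R =2 coefficients R' -> R = R'.
Proof.
move=> E; apply/lfunP => x; apply/ffunP => k; rewrite !coefficientsE.
by apply: eq_bigr => i _; rewrite E.
Qed.

Definition of_coefficients_fun (m : 'I_n -> 'I_n -> F) (x : A) : A :=
  [ffun k => \sum_i (x i : F) * m i k].

Fact of_coefficients_is_linear m : linear (of_coefficients_fun m).
Proof.
move=> c x y; apply/ffunP => k.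
rewrite direct_sum_addE direct_sum_scaleE !ffunE mulr_sumr -big_split /=.
apply: eq_bigr => i _.
by rewrite direct_sum_addE direct_sum_scaleE mulrDl mulrA.
Qed.

HB.instance Definition _ m := GRing.isLinear.Build F A A _
  (of_coefficients_fun m) (of_coefficients_is_linear m).

Definition of_coefficients m : 'End(A) := linfun (of_coefficients_fun m).

Lemma of_coefficientsK m : coefficients (of_coefficients m) =2 m.
Proof.
move=> i k; rewrite /coefficients lfunE /= ffunE (bigD1 i) //= big1 => [|j ji].
  by rewrite ffunE eqxx mul1r addr0.
by rewrite ffunE (negPf ji) mul0r.
Qed.

(** Both sides of the operator identity are bilinear in [x] and [y], so it suffices to compare
    coefficients of [x i * y j]. *)
Lemma rota_baxter_coefficients lambda (R : 'End(A)) :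
  rota_baxter lambda R <-> rb_coefficients lambda (coefficients R).
Proof.
set m := coefficients R.
have mulE (x y : A) k : (R x * R y) k =
    \sum_i \sum_j (x i : F) * (y j : F) * (m i k * m j k).
  rewrite direct_sum_mulE !coefficientsE mulr_suml.
  apply: eq_bigr => i _; rewrite mulr_sumr; apply: eq_bigr => j _.
  by rewrite mulrACA.
have argE (x y : A) k : R (R x * y + x * R y + lambda *: (x * y)) k =
    \sum_i \sum_j (x i : F) * (y j : F) *
      (m i j * m j k + m j i * m i k + lambda * (i == j)%:R * m i k).
  (* The contributions of [R x * y], [x * R y] and [lambda *: (x * y)]. In the first, the outer
     index of the expansion belongs to [y], hence the later [exchange_big]. *)
  pose S1 := \sum_i \sum_j (x i : F) * (y j : F) * (m i j * m j k).
  pose S2 := \sum_i \sum_j (x i : F) * (y j : F) * (m j i * m i k).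
  pose S3 := \sum_i (x i : F) * (y i : F) * (lambda * m i k).
  transitivity (S1 + S2 + S3).
    rewrite coefficientsE /S1 exchange_big /S2 /S3 -!big_split /=.
    apply: eq_bigr => i _.
    rewrite !direct_sum_addE direct_sum_scaleE !direct_sum_mulE !coefficientsE.
    rewrite !mulrDl mulr_sumr !mulr_suml.
    have perm_l (b c d e : F) : b * c * d * e = b * d * (c * e) by ring.
    have perm_r (b c d e : F) : b * (c * d) * e = b * c * (d * e) by ring.
    have perm_d (b c d e : F) : b * (c * d) * e = c * d * (b * e) by ring.
    congr (_ + _ + _); [| |exact: perm_d].
      by apply: eq_bigr => j _; apply: perm_l.
    by apply: eq_bigr => j _; apply: perm_r.
  rewrite /S1 /S2 /S3 -!big_split /=; apply: eq_bigr => i _.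
  (* The single sum [S3] is absorbed into the double sum as its diagonal [j = i]. *)
  rewrite -big_split /= (bigD1 i) //= [RHS](bigD1 i) //= eqxx mulr1 addrAC.
  congr (_ + _); first by rewrite -!mulrDr.
  apply: eq_bigr => j ji.
  by rewrite [i == j]eq_sym (negPf ji) mulr0 mul0r addr0 mulrDr.
split=> [[_ RB] i j k|mP].
  have sumE (f : 'I_n -> 'I_n -> F) :
      \sum_u \sum_v (basis_vector i u : F) * (basis_vector j v : F) * f u v
      = f i j.
    transitivity
      (\sum_v (basis_vector i i : F) * (basis_vector j v : F) * f i v).
      rewrite (bigD1 i) //= [X in _ + X]big1 ?addr0 // => u ui.
      by apply: big1 => v _; rewrite ffunE (negPf ui) !mul0r.
    rewrite (bigD1 j) //= big1 => [|v vj].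
      by rewrite !ffunE !eqxx !mul1r addr0.
    by rewrite [in X in _ * X * _]ffunE (negPf vj) mulr0 mul0r.
  have := RB (basis_vector i) (basis_vector j).
  by move/(congr1 (fun z : A => z k)); rewrite mulE argE !sumE.
split=> [|x y]; first exact: linearP.
apply/ffunP => k; rewrite mulE argE.
by apply: eq_bigr => i _; apply: eq_bigr => j _; rewrite mP.
Qed.

End Operators.

Theorem theorem1 (F : fieldType) (n : nat) (n_gt0 : (0 < n)%N) (lambda : F)
    (lambda_neq0 : (lambda != 0)%R) :
  exists s : seq 'End(direct_sum F n_gt0),
    [/\ uniq s,
        forall R : 'End(direct_sum F n_gt0), R \in s <-> rota_baxter lambda R
      & size s = (2 ^ n * n.+1 ^ n.-1)%N].
Proof.
pose E := setX [set: {set 'I_n}] [set a | forest_order [set: 'I_n] a].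
pose op (p : {set 'I_n} * {set 'I_n * 'I_n}) :=
  of_coefficients n_gt0 (forest_coef lambda p.1 p.2).
exists [seq op p | p <- enum E]; split.
- rewrite map_inj_in_uniq ?enum_uniq // => -[D a] [D' a'].
  rewrite !mem_enum !in_setX !in_set /= => aP a'P eq_op.
  suff [-> ->] : D = D' /\ a = a' by [].
  apply: (forest_coef_inj lambda_neq0 aP a'P) => i k.
  rewrite -(of_coefficientsK n_gt0) -[RHS](of_coefficientsK n_gt0).
  by rewrite -/(op (D, a)) eq_op.
- move=> R; rewrite rota_baxter_coefficients; split.
    case/mapP => -[D a]; rewrite mem_enum !in_setX !in_set /= => aP ->.
    move=> i j k; rewrite !of_coefficientsK.
    exact: forest_order_rb_coefficients.
  case/rb_coefficients_forest => // D [a [aP RE]].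
  apply/mapP; exists (D, a); first by rewrite mem_enum in_setX !in_set.
  by apply: coefficients_inj => i k; rewrite RE of_coefficientsK.
(* The free choice of [D] gives [2 ^ n]; [Ordinal n_gt0] serves as the default point [t0] for
   counting forests. *)
- rewrite size_map -cardE cardsX -powersetT card_powerset cardsT card_ord.
  congr (_ * _); have cT : #|'I_n| = n.-1.+1 by rewrite card_ord prednK.
  by rewrite (card_forest_orders (Ordinal n_gt0) cT) card_ord.
Qed.
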